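(* Let $A$ be the kneading automaton over $X=\{0,1\}$ with kneading sequence $01(10)^{\omega}$, i.e. the automaton with states $a,b,c,t,id$ described in the context. Then $G(A)$ admits no admissible length function: for every weight function $\widehat{\ell}:A-\{id\}\to\mathbb{R}^{+}$ and every choice of a set $T$ of minimal representatives, the length function $\ell$ induced by $\widehat{\ell}$ is not admissible.
   Context: Let $X=\{0,1\}$ and let $X^{*}$ be the free monoid on $X$, viewed as a rooted binary tree. The automaton $A$ has states $a,b,c,t,id$, which act as automorphisms of $X^{*}$ fixing the empty word and given recursively by: $id$ is the identity; $t(0w)=1w$, $t(1w)=0w$; and, writing $(g_0,g_1)$ for the automorphism $jw\mapsto j\,g_j(w)$ ($j\in X$), $a=(t,1)$, $b=(c,a)$, $c=(1,b)$. $G(A)\le\mathrm{Aut}(X^{*})$ is the group generated by $a,b,c,t$. Each of $a,b,c,t$ has order 2. Put $S=\{a,b,c\}$, $H=\langle S\rangle\le G(A)$. Given $\widehat{\ell}:A-\{id\}\to\mathbb{R}^{+}$ (positive reals) and $w=a_1\cdots a_n\in(A-\{id\})^{*}$, put $|w|=\sum\widehat{\ell}(a_i)$ and $\ell(w)=\min\{|v|: v\in(A-\{id\})^{*},\ v=w\text{ in }G(A)\}$. A set $T$ of minimal representatives consists of one word $w_h\in S^{*}$ for each $h\in H$, such that $w_h=h$ in $G(A)$ and $|w_h|\le|\widehat w|$ for every $\widehat w\in S^{*}$ representing $h$. The map $r:(A-\{id\})^{*}\to(A-\{id\})^{*}$ replaces each maximal subword over $S$ by its representative in $T$, without cancelling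 any $t$'s. For $w\in T$ (a word in $S^{*}$), its first-line production is $(w_0,w_1)$, where $w_j=r(\widetilde w_j)$ and $\widetilde w_j\in(A-\{id\})^{*}$ is obtained from $w$ by replacing each letter $s=(s_{|0},s_{|1})$ by $s_{|j}$ (omitting trivial entries, with no cancellation). The length function $\ell$ is admissible if $|t|+|w|\ge|w_0|+|w_1|$ for all $w\in T$. *)

(* Defs.v *)
From mathcomp Require Import all_boot all_order all_algebra.
From mathcomp Require Import reals.

Set Implicit Arguments.
Unset Strict Implicit.
Unset Printing Implicit Defensive.

Import Order.TTheory GRing.Theory Num.Theory.
Local Open Scope ring_scope.

(* The states of A other than id; the state set of A is [option letter], with
   [None] standing for id. *)
Inductive letter := La | Lb | Lc | Lt.

(* [word] is (A - {id})^* and [vertex] is X^*, with X = bool, 0 = false and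
   1 = true. *)
Notation word := (seq letter).
Notation vertex := (seq bool).

(* a = (t, 1), b = (c, a), c = (1, b), while t = (1, 1) followed by the swap
   of 0 and 1. *)
Definition restr (x : bool) (s : letter) : option letter :=
  match s, x with
  | La, false => Some Lt
  | La, true  => None
  | Lb, false => Some Lc
  | Lb, true  => Some La
  | Lc, false => None
  | Lc, true  => Some Lb
  | Lt, _     => None
  end.

Definition out (s : letter) (x : bool) : bool := if s is Lt then ~~ x else x.

Fixpoint act (q : option letter) (v : vertex) : vertex :=
  match q, v with
  | Some s, x :: v' => out s x :: act (restr x s) v'
  | _, _ => v
  end.

(* Each letter is an automorphism of order 2 of the rooted tree X^*. *)
Lemma actK q : involutive (act q).
Proof. by move=> v; elim: v q => [[]|x v IHv [[]|]] //=; case: x; rewrite /= IHv. Qed.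

Lemma size_act q v : size (act q v) = size v.
Proof. by elim: v q => [[]|x v IHv [s|]] //=; rewrite IHv. Qed.

Lemma take_act q n v : act q (take n v) = take n (act q v).
Proof. by elim: v n q => [|x v IHv] [|n] [s|] //=; rewrite IHv. Qed.

Lemma act_neq_id s : act (Some s) <> id.
Proof.
by case: s => /(congr1 (fun f => (f [:: false; false], f [:: true; false; false],
  f [:: true; true; false; false]))).
Qed.

(* The element of G(A) represented by a word, for left actions: the last letter
   acts first.  Since the letters are involutions, right actions would only
   replace [eval w] by its inverse, so that the relation [eval v = eval w]
   ("v = w in G(A)") does not depend on this choice. *)
Definition eval (w : word) : vertex -> vertex :=
  foldr (fun s f => act (Some s) \o f) id w.

(* The subgroup generated by a set [P] of permutations of X^*. *)
Inductive generated (P : (vertex -> vertex) -> Prop) :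
    (vertex -> vertex) -> Prop :=
| gen_id : generated P id
| gen_in g : P g -> generated P g
| gen_mul g h : generated P g -> generated P h -> generated P (g \o h)
| gen_inv g h : generated P g -> cancel g h -> cancel h g -> generated P h.

Definition inS (s : letter) : bool := if s is Lt then false else true.

Definition H : (vertex -> vertex) -> Prop :=
  generated (fun g => exists2 s, inS s & g = act (Some s)).

Definition weight (R : realType) (lhat : letter -> R) (w : word) : R :=
  \sum_(s <- w) lhat s.

(* A set T = {w_h | h in H} of minimal representatives is given by the map
   h |-> w_h, whose values outside H are irrelevant. *)
Definition minimal_representatives (R : realType) (lhat : letter -> R)
    (T : (vertex -> vertex) -> word) : Prop :=
  forall h, H h ->
    [/\ all inS (T h), eval (T h) = h
      & forall v, all inS v -> eval v = h -> weight lhat (T h) <= weight lhat v].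

(* [u] is the part already read of the current maximal subword over S.  Empty
   subwords (next to a t at either end of the word, or between two t's) are
   harmless: for positive weights the minimal representative of the identity
   is the empty word. *)
Fixpoint r_rec (T : (vertex -> vertex) -> word) (u w : word) : word :=
  match w with
  | [::] => T (eval u)
  | s :: w' => if inS s then r_rec T (rcons u s) w'
               else T (eval u) ++ s :: r_rec T [::] w'
  end.

Definition r (T : (vertex -> vertex) -> word) (w : word) : word :=
  r_rec T [::] w.

(* The component w_x of the first-line production (w_0, w_1) of w. *)
Definition production (T : (vertex -> vertex) -> word) (x : bool) (w : word) :
    word :=
  r T (pmap (restr x) w).

(* Admissibility of the length function induced by [lhat], relative to T: the
   condition bears only on the weights of words, not on the minimum of these
   weights over all the words representing a given element of G(A). *)
Definition admissible (R : realType) (lhat : letter -> R)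
    (T : (vertex -> vertex) -> word) : Prop :=
  forall h, H h ->
    weight lhat (production T false (T h)) + weight lhat (production T true (T h))
      <= lhat Lt + weight lhat (T h).

(* Main.v *)
(** Take h = (bac)^2 in H.  Its first coordinate is (ct)^2 = (b, b) and its second
    one is (ab)^2 = ((tc)^2, 1).  A word over {t, c} with value (b, b) has at
    least two letters t and two letters c; the map r only cancels squares of c in
    words over {t, c}, so that |w_0| >= 2|t| + 2|c|.  A word over S with value
    (ab)^2 has at least two letters a and two letters b, so that
    |w_1| >= 2|a| + 2|b|.  As |w| <= |bacbac|, admissibility at h would give
    |t| <= 0. *)
Require Import Defs.
From HB Require Import structures.
From Stdlib Require Import FunctionalExtensionality.
From mathcomp Require Import all_boot all_order all_algebra.
From mathcomp Require Import reals lra.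

Set Implicit Arguments.
Unset Strict Implicit.

Import Order.TTheory GRing.Theory Num.Theory.
Local Open Scope ring_scope.

(** This numbering only gives [letter] the decidable equality that [count_mem] requires. *)
Definition nat_of_letter (s : letter) : nat :=
  match s with La => 0 | Lb => 1 | Lc => 2 | Lt => 3 end.

Definition letter_of_nat (n : nat) : letter :=
  match n with 0 => La | 1 => Lb | 2 => Lc | _ => Lt end.

Lemma nat_of_letterK : cancel nat_of_letter letter_of_nat.
Proof. by case. Qed.

HB.instance Definition _ := Equality.copy letter (can_type nat_of_letterK).

Lemma act_None v : act None v = v.
Proof. by case: v. Qed.

Lemma eval_cat u v x : eval (u ++ v) x = eval u (eval v x).
Proof. by elim: u => //= s u ->. Qed.

(** * Words over S and the element (ab)^2 *)

Lemma eval_in_H w : all inS w -> H (eval w).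
Proof.
elim: w => [_|s w IHw /= /andP[Ss Sw]]; first exact: gen_id.
by apply: gen_mul (IHw Sw); apply: gen_in; exists s.
Qed.

Lemma eval_cons w x v : all inS w ->
  eval w (x :: v) = x :: eval (pmap (restr x) w) v.
Proof.
elim: w => //= s w IHw /andP[Ss Sw]; rewrite IHw //.
by clear IHw; case: s Ss; case: x => //= _; rewrite act_None.
Qed.

(** Here and in the next two lemmas the vertex is chosen so that exactly one letter of S flips its
    last bit and the other two fix it. The parity of each letter count is thus an invariant of the
    element of H. *)
Lemma eval_La_parity w x : all inS w ->
  eval w [:: false; x] = [:: false; x (+) odd (count_mem La w)].
Proof.
elim: w => [|s w IHw] /=; first by rewrite addbF.
by case: s => //= /IHw -> /=; rewrite ?add0n ?add1n /= ?addbN; case: (_ (+) _).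
Qed.

Lemma eval_Lb_parity w x : all inS w ->
  eval w [:: true; false; x] = [:: true; false; x (+) odd (count_mem Lb w)].
Proof.
elim: w => [|s w IHw] /=; first by rewrite addbF.
by case: s => //= /IHw -> /=; rewrite ?add0n ?add1n /= ?addbN; case: (_ (+) _).
Qed.

Lemma eval_Lc_parity w x : all inS w ->
  eval w [:: true; true; false; x]
    = [:: true; true; false; x (+) odd (count_mem Lc w)].
Proof.
elim: w => [|s w IHw] /=; first by rewrite addbF.
by case: s => //= /IHw -> /=; rewrite ?add0n ?add1n /= ?addbN; case: (_ (+) _).
Qed.

Lemma eval_La_free w v : all inS w -> count_mem La w = 0 ->
  eval w [:: false, false & v] = [:: false, false & v].
Proof. by elim: w => //= -[] //= w IHw Sw n0; rewrite IHw //= ?act_None. Qed.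

Lemma eval_Lb_free w x v : all inS w -> count_mem Lb w = 0 ->
  exists y, eval w [:: false, x & v] = [:: false, y & v].
Proof.
elim: w => [|s w IHw] /=; first by exists x.
by case: s => //= Sw n0; have [y ->] := IHw Sw n0;
  [exists (~~ y) | exists y]; rewrite /= ?act_None.
Qed.

Lemma even_gt0_ge2 n : ~~ odd n -> n <> 0 -> (2 <= n)%N.
Proof. by case: n => [|[]]. Qed.

(** The parity invariants make both counts even. They are nonzero because (ab)^2 flips the last bit
    of 00100, whereas a word without a fixes this vertex and a word without b, acting below 0 as a
    power of t, changes at most its second bit. *)
Lemma abab_counts w : all inS w -> eval w =1 eval [:: La; Lb; La; Lb] ->
  (2 <= count_mem La w)%N /\ (2 <= count_mem Lb w)%N.
Proof.
move=> Sw Ew; split; apply: even_gt0_ge2.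
- by have := eval_La_parity false Sw; rewrite Ew /= => -[<-].
- by move=> /(eval_La_free [:: true; false; false] Sw); rewrite Ew.
- by have := eval_Lb_parity false Sw; rewrite Ew /= => -[<-].
- by move=> /(eval_Lb_free false [:: true; false; false] Sw)[y]; rewrite Ew.
Qed.

(** * Words over {t, c} and the element (ct)^2 *)

Definition in_tc (s : letter) : bool := (s == Lt) || (s == Lc).

Lemma eval_Lt_parity w x : all in_tc w ->
  eval w [:: x] = [:: x (+) odd (count_mem Lt w)].
Proof.
elim: w => [|s w IHw] /=; first by rewrite addbF.
by case: s => //= /IHw -> /=; rewrite ?add0n ?add1n /= ?addbN; case: (_ (+) _).
Qed.

Lemma eval_Lt_free w v : all in_tc w -> count_mem Lt w = 0 ->
  eval w (false :: v) = false :: v.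
Proof. by elim: w => //= -[] //= w IHw Sw n0; rewrite IHw //= ?act_None. Qed.

Lemma eval_Lc_free w x v : all in_tc w -> count_mem Lc w = 0 ->
  exists y, eval w (x :: v) = y :: v.
Proof.
elim: w => [|s w IHw] /=; first by exists x.
by case: s => //= Sw n0; have [y ->] := IHw Sw n0; rewrite /= act_None; exists (~~ y).
Qed.

(* A word over {t, c} is (b^i, b^j), up to the swap; y and z are the parities
   of i and j, and i + j has the parity of the number of letters c. *)
Lemma eval_tc_parity w : all in_tc w -> exists x y z,
  [/\ eval w [:: false; true; false; false] = [:: x; true; false; y],
      eval w [:: true; true; false; false] = [:: ~~ x; true; false; z]
    & y (+) z = odd (count_mem Lc w)].
Proof.
elim: w => [_|s w IHw]; first by exists false, false, false.
case: s => //= /IHw[x [y [z [-> -> <-]]]].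
  by case: x; [exists true, (~~ y), z | exists false, y, (~~ z)];
     split=> //; rewrite ?addNb ?addbN.
by exists (~~ x), y, z.
Qed.

(** The test vertex is now 0100, whose last bit (ct)^2 = (b, b) flips: a word without t fixes it,
    and a word without c changes at most its first bit. The number of letters c is even because both
    coordinates are b. *)
Lemma ctct_counts w : all in_tc w -> eval w =1 eval [:: Lc; Lt; Lc; Lt] ->
  (2 <= count_mem Lt w)%N /\ (2 <= count_mem Lc w)%N.
Proof.
move=> Sw Ew; split; apply: even_gt0_ge2.
- by have := eval_Lt_parity false Sw; rewrite Ew /= => -[<-].
- by move=> /(eval_Lt_free [:: true; false; false] Sw); rewrite Ew.
- by have [x [y [z]]] := eval_tc_parity Sw; rewrite !Ew /= => -[[_ <-] [_ <-] <-].
- by move=> /(eval_Lc_free false [:: true; false; false] Sw)[y]; rewrite Ew.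
Qed.

(** * Weights and the map r *)

Lemma eval_Lc_word w : all (pred1 Lc) w ->
  eval w = eval (nseq (odd (size w)) Lc).
Proof.
elim: w => // s w IHw /= /andP[/eqP-> /IHw ->].
by case: odd => //; apply: functional_extensionality => v /=; rewrite actK.
Qed.

Lemma all_Lc_inS w : all (pred1 Lc) w -> all inS w.
Proof. by apply: sub_all => s /eqP->. Qed.

Section Weights.

Variables (R : realType) (lhat : letter -> R) (T : (vertex -> vertex) -> word).
Hypothesis lhat_gt0 : forall s : letter, 0 < lhat s.

Lemma weightE w : weight lhat w =
  lhat La *+ count_mem La w + lhat Lb *+ count_mem Lb w
  + lhat Lc *+ count_mem Lc w + lhat Lt *+ count_mem Lt w.
Proof.
rewrite /weight; elim: w => [|s w IHw]; first by rewrite big_nil !addr0.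
by rewrite big_cons IHw; case: s; rewrite /= ?add0n mulrS; lra.
Qed.

Lemma lhat_mulrn_ge0 s n : 0 <= lhat s *+ n.
Proof. by rewrite mulrn_wge0 // ltW. Qed.

Lemma lhat_mulrn_le s m n : (m <= n)%N -> lhat s *+ m <= lhat s *+ n.
Proof. by move=> le_mn; rewrite ler_pMn2l. Qed.

Hypothesis T_min : minimal_representatives lhat T.

(** The value of [u] is 1 or c. By parity its representative has at least as many letters c as the
    reduced power of c, and by minimality it weighs no more, so positive weights exclude every other
    letter. *)
Lemma T_Lc_word u : all (pred1 Lc) u -> all (pred1 Lc) (T (eval u)).
Proof.
move=> cu; have [] := T_min (eval_in_H (all_Lc_inS cu)).
set w := T _ => Sw Ew wmin.
have le_c : (odd (size u) <= count_mem Lc w)%N.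
  have := eval_Lc_parity false Sw; rewrite Ew eval_Lc_word //.
  by case: odd => //= -[]; case: count.
have := wmin (nseq (odd (size u)) Lc); rewrite (eval_Lc_word cu).
move=> /(_ (ltac:(by case: odd)) erefl).
rewrite [X in _ <= X]weightE !count_nseq /= !mulr0n add0r addr0 mul1n weightE.
have le_lc := lhat_mulrn_le Lc le_c.
move=> le_w.
have free s : s \in [:: La; Lb; Lt] -> count_mem s w = 0.
  move=> s_in; apply/eqP; rewrite -leqn0 leqNgt; apply/negP.
  move=> /(lhat_mulrn_le s); have := lhat_gt0 s.
  move: (lhat_mulrn_ge0 La (count_mem La w)) (lhat_mulrn_ge0 Lb (count_mem Lb w)).
  move: (lhat_mulrn_ge0 Lt (count_mem Lt w)); rewrite mulr1n.
  by move: s_in; rewrite !inE => /or3P[] /eqP->; lra.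
apply/allP => s sw; apply/eqP.
by have := free s; case: s sw => // sw /(_ isT) /count_memPn; rewrite sw.
Qed.

(** In a word over {t, c} the maximal subwords over S are powers of c, whose representatives stay
    powers of c. Hence letter counts over {t, c} still apply after r. *)
Lemma r_rec_tc u w : all (pred1 Lc) u -> all in_tc w ->
  all in_tc (r_rec T u w) /\ eval (r_rec T u w) =1 eval (u ++ w).
Proof.
elim: w u => [|s w IHw] u cu /=.
  have [_ ET _] := T_min (eval_in_H (all_Lc_inS cu)).
  rewrite cats0 ET; split=> //; apply: sub_all (T_Lc_word cu).
  by move=> s /eqP->.
case: s => //= Sw.
  have [||Sr Er] := IHw (rcons u Lc) => //; first by rewrite all_rcons.
  by rewrite cat_rcons in Er.
have [_ ET _] := T_min (eval_in_H (all_Lc_inS cu)).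
have [//|//|Sr Er] := IHw [::].
split=> [|x]; last by rewrite !eval_cat ET /= Er.
rewrite all_cat /= Sr andbT; apply: sub_all (T_Lc_word cu).
by move=> s /eqP->.
Qed.

Lemma r_rec_inS u w : all inS w -> r_rec T u w = T (eval (u ++ w)).
Proof.
elim: w u => [|s w IHw] u /=; first by rewrite cats0.
by case/andP=> -> Sw; rewrite IHw // cat_rcons.
Qed.

End Weights.

Theorem proposition5p1 (R : realType) (lhat : letter -> R)
    (T : (vertex -> vertex) -> word)
    (lhat_gt0 : forall s : letter, 0 < lhat s)
    (T_min : minimal_representatives lhat T) :
  ~ admissible lhat T.
Proof.
pose w0 := [:: Lb; La; Lc; Lb; La; Lc].
have Hh : H (eval w0) by apply: eval_in_H.
move=> /(_ _ Hh); have [Sw Ew /(_ w0 isT erefl)] := T_min _ Hh.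
move: (T _) Sw Ew => w Sw Ew.
(* The representative [w] is unknown, but its coordinates have the same values as those of [w0],
   which are the words ctct and abab. *)
have Esub x : eval (pmap (restr x) w) =1 eval (pmap (restr x) w0).
  by move=> v; have := eval_cons x v Sw; rewrite Ew eval_cons // => -[].
have Su0 : all in_tc (pmap (restr false) w).
  by elim: w Sw {Ew Esub} => //= -[].
have Su1 : all inS (pmap (restr true) w).
  by elim: w Sw {Ew Esub Su0} => //= -[].
have [Sr0 Er0] := r_rec_tc lhat_gt0 T_min (isT : all (pred1 Lc) [::]) Su0.
have [nt nc] := ctct_counts Sr0 (fun v => etrans (Er0 v) (Esub false v)).
have [Sr1 Er1 _] := T_min _ (eval_in_H Su1).
(* The second coordinate contains no t, so r replaces it as a whole by one word over S. *)
rewrite -(r_rec_inS T [::] Su1) in Sr1 Er1.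
have [na nb] := abab_counts Sr1
  (fun v => etrans (congr1 (@^~ v) Er1) (Esub true v)).
have -> : weight lhat w0 = lhat La *+ 2 + lhat Lb *+ 2 + lhat Lc *+ 2.
  by rewrite weightE addr0.
rewrite /production /r.
rewrite [weight _ (r_rec _ _ (pmap (restr false) w))]weightE.
rewrite [weight _ (r_rec _ _ (pmap (restr true) w))]weightE.
move: (lhat_mulrn_le lhat_gt0 Lt nt) (lhat_mulrn_le lhat_gt0 Lc nc).
move: (lhat_mulrn_le lhat_gt0 La na) (lhat_mulrn_le lhat_gt0 Lb nb).
set r1 := r_rec T [::] _; set r0 := r_rec T [::] _.
move: (lhat_mulrn_ge0 lhat_gt0 La (count_mem La r0)) (lhat_mulrn_ge0 lhat_gt0 Lb (count_mem Lb r0)).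
move: (lhat_mulrn_ge0 lhat_gt0 Lc (count_mem Lc r1)) (lhat_mulrn_ge0 lhat_gt0 Lt (count_mem Lt r1)).
by have := lhat_gt0 Lt; rewrite !mulr2n; lra.
Qed.
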